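(* Let $\theta=(k_r)$ be a lacunary sequence and let $q_r=k_r/k_{r-1}$. If $1<\liminf_{r} q_r\le\limsup_{r} q_r<\infty$, then $AC_{\theta}=AC_{\sigma_1}$.
   Context: Let $w$ be the space of all sequences $x=(x_k)_{k\in\mathbb{N}}$ of complex numbers. For integers $m,n$, $\langle m,n\rangle$ denotes the greatest common divisor of $m$ and $n$. A lacunary sequence is an increasing sequence of integers $\theta=(k_r)_{r\ge 0}$, with $k_0\neq 0$, such that $h_r=k_r-k_{r-1}\to\infty$ as $r\to\infty$; put $I_r=(k_{r-1},k_r]$ and $q_r=k_r/k_{r-1}$ for $r\ge 1$ (the indices $m\in I_r$ below are natural numbers). Define $$AC_{\theta}=\left\{(x_m)\in w:\ \lim_{r\to\infty}\frac{1}{h_r}\sum_{m\in I_r}\left|x_m-x_{\langle m,n\rangle}\right|=0\ \text{for some integer } n\right\},$$ $$AC_{\sigma_1}=\left\{(x_m)\in w:\ \text{there exists an integer } n \text{ such that } \frac{1}{t}\sum_{m=1}^{t}\left|x_m-x_{\langle m,n\rangle}\right|\to 0\ \text{as } t\to\infty\right\}.$$ *)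

(* Defs.v *)
From Stdlib Require Import Reals ZArith Ensembles.
From Coquelicot Require Import Coquelicot.

Open Scope R_scope.

(* A sequence [(x_m)] is a function [nat -> C]. Only positive indices occur
   below, so the value at [0] plays no role. *)

Definition gcd_index (m : nat) (n : Z) : nat := Z.to_nat (Z.gcd (Z.of_nat m) n).

(* |x_m - x_<m,n>| *)
Definition arith_dev (x : nat -> C) (n : Z) (m : nat) : R :=
  Cmod (x m - x (gcd_index m n))%C.

(* [h k r] and [q k r] are h_{r+1} and q_{r+1}: these are defined for
   indices >= 1 in the usual numbering. *)
Definition h (k : nat -> Z) (r : nat) : R := IZR (k (S r) - k r).

Definition q (k : nat -> Z) (r : nat) : R := IZR (k (S r)) / IZR (k r).

Definition lacunary (k : nat -> Z) : Prop :=
  (forall r : nat, (k r < k (S r))%Z) /\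
  k 0%nat <> 0%Z /\
  is_lim_seq (h k) p_infty.

(* Sum over the m >= 1 in the interval (k_r, k_{r+1}]. [Z.to_nat] sends negative
   integers to 0, so the range is correct even if some k_r are negative. *)
Definition block_sum (k : nat -> Z) (a : nat -> R) (r : nat) : R :=
  sum_n_m a (S (Z.to_nat (k r))) (Z.to_nat (k (S r))).

(* In both definitions the integer n is nonzero: since gcd(m, 0) = m, allowing
   n = 0 would put every sequence in both sets. *)
Definition AC_theta (k : nat -> Z) : Ensemble (nat -> C) :=
  fun x => exists n : Z, n <> 0%Z /\
    is_lim_seq (fun r => 1 / h k r * block_sum k (arith_dev x n) r) 0.

Definition AC_sigma1 : Ensemble (nat -> C) :=
  fun x => exists n : Z, n <> 0%Z /\
    is_lim_seq (fun t => 1 / INR t * sum_n_m (arith_dev x n) 1 t) 0.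

(* Main.v *)
(** For a nonnegative sequence [a] with partial sums [S t], the block sum over
    [(k_r, k_{r+1}]] is [S k_{r+1} - S k_r]. If [q_r >= 1 + d] eventually, then
    [k_{r+1} <= ((1 + d) / d) h_r], so [block_r / h_r] is at most a constant times
    [S k_{r+1} / k_{r+1}]. If [q_r <= M] eventually and [block_r <= e h_r] for
    [r >= N], telescoping gives [S k_r <= S k_N + e k_r], and then
    [S t <= S k_N + e M t] for [k_r <= t < k_{r+1}]. Thus the same [n] witnesses
    membership in both sets. *)

Require Import Defs.
From Stdlib Require Import Reals ZArith Ensembles.
From Stdlib Require Import Lra Lia.
From Stdlib Require Import FunctionalExtensionality PropExtensionality.
From Coquelicot Require Import Coquelicot.

(** Half the gap between [c] and a finite lower limit serves as [d]. A uniform margin is needed: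
    [q > 1] alone does not bound [k_{r+1} / h_r]. *)
Lemma LimInf_seq_gt_eventually (u : nat -> R) (c : R) :
  Rbar_lt c (LimInf_seq u) ->
  exists d : R, 0 < d /\ eventually (fun n => c + d < u n).
Proof.
  intros Hc.
  pose proof (proj2_sig (ex_LimInf_seq u)) as HL.
  fold (LimInf_seq u) in HL.
  destruct (LimInf_seq u) as [l | |]; simpl in Hc, HL.
  - assert (He : 0 < (l - c) / 2) by lra.
    exists ((l - c) / 2); split; [exact He |].
    destruct (HL (mkposreal _ He)) as [_ [N HN]].
    exists N; intros n Hn; specialize (HN n Hn); simpl in HN; lra.
  - exists 1; split; [lra |].
    exact (HL (c + 1)).
  - easy.
Qed.

Lemma LimSup_seq_bounded_eventually (u : nat -> R) :
  Rbar_lt (LimSup_seq u) p_infty ->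
  exists M : R, eventually (fun n => u n < M).
Proof.
  intros Hc.
  pose proof (proj2_sig (ex_LimSup_seq u)) as HL.
  fold (LimSup_seq u) in HL.
  destruct (LimSup_seq u) as [l | |]; simpl in Hc, HL.
  - exists (l + 1).
    destruct (HL (mkposreal 1 Rlt_0_1)) as [_ HN].
    exact HN.
  - easy.
  - exists 0; exact (HL 0).
Qed.

Lemma sum_n_m_nonneg (a : nat -> R) (n m : nat) :
  (forall i, 0 <= a i) -> 0 <= sum_n_m a n m.
Proof.
  intros Ha.
  apply Rle_trans with (sum_n_m (fun _ : nat => 0) n m).
  - rewrite sum_n_m_const, Rmult_0_r; apply Rle_refl.
  - now apply sum_n_m_le.
Qed.

Lemma sum_from_1_split (a : nat -> R) (m n : nat) : (m <= n)%nat ->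
  sum_n_m a 1 n = sum_n_m a 1 m + sum_n_m a (S m) n.
Proof.
  intros Hmn.
  apply (sum_n_m_Chasles a 1 m n); lia.
Qed.

Lemma sum_from_1_le (a : nat -> R) (m n : nat) :
  (forall i, 0 <= a i) -> (m <= n)%nat -> sum_n_m a 1 m <= sum_n_m a 1 n.
Proof.
  intros Ha Hmn.
  rewrite (sum_from_1_split a m n Hmn).
  pose proof (sum_n_m_nonneg a (S m) n Ha); lra.
Qed.

Section IncreasingIndices.

Variables (k : nat -> Z) (a : nat -> R).
Hypothesis k_incr : forall r, (k r < k (S r))%Z.
Hypothesis a_nonneg : forall i, 0 <= a i.

Lemma incr_ge_linear (r : nat) : (k 0 + Z.of_nat r <= k r)%Z.
Proof.
  induction r as [| r IH]; [lia |].
  specialize (k_incr r); lia.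
Qed.

(** Strictly increasing integers grow at least linearly. This permits substituting [t = k_r] in a
    limit over [t]. *)
Lemma incr_unbounded : filterlim (fun r => Z.to_nat (k r)) eventually eventually.
Proof.
  intros P [N HN].
  exists (N + Z.to_nat (- k 0))%nat.
  intros r Hr; apply HN.
  pose proof (incr_ge_linear r); lia.
Qed.

Lemma incr_eventually_pos : eventually (fun r => (0 < k r)%Z).
Proof.
  exists (S (Z.to_nat (- k 0))).
  intros r Hr; pose proof (incr_ge_linear r); lia.
Qed.

Lemma INR_to_nat (z : Z) : (0 <= z)%Z -> INR (Z.to_nat z) = IZR z.
Proof.
  intros Hz; now rewrite INR_IZR_INZ, Z2Nat.id.
Qed.

Lemma h_pos (r : nat) : 0 < h k r.
Proof.
  apply (IZR_lt 0); specialize (k_incr r); lia.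
Qed.

(** [Z.to_nat] is monotone, so the splitting survives the truncation of negative [k r] to 0. *)
Lemma block_sum_partial_sums (r : nat) :
  sum_n_m a 1 (Z.to_nat (k (S r))) =
  sum_n_m a 1 (Z.to_nat (k r)) + block_sum k a r.
Proof.
  apply sum_from_1_split; specialize (k_incr r); lia.
Qed.

Lemma block_means_of_means :
  Rbar_lt 1 (LimInf_seq (q k)) ->
  is_lim_seq (fun t => 1 / INR t * sum_n_m a 1 t) 0 ->
  is_lim_seq (fun r => 1 / h k r * block_sum k a r) 0.
Proof.
  intros Hinf Hlim.
  destruct (LimInf_seq_gt_eventually _ _ Hinf) as [d [Hd Hq]].
  set (u := fun t => 1 / INR t * sum_n_m a 1 t) in Hlim.
  apply is_lim_seq_le_le_loc
    with (u := fun _ => 0) (w := fun r => (1 + d) / d * u (Z.to_nat (k (S r)))).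
  - generalize (filter_and _ _ Hq incr_eventually_pos).
    apply filter_imp; intros r [Hqr Hkr].
    pose proof (h_pos r) as Hh.
    pose proof (k_incr r) as Hk.
    assert (Hkr' : 0 < IZR (k r)) by now apply (IZR_lt 0).
    assert (Hks : 0 < IZR (k (S r))) by (apply (IZR_lt 0); lia).
    assert (Hdk : (1 + d) * IZR (k r) < IZR (k (S r)))
      by (apply (Rlt_div_r _ _ _ Hkr'); exact Hqr).
    assert (Hb : 0 <= block_sum k a r) by now apply sum_n_m_nonneg.
    assert (Hbs : block_sum k a r <= sum_n_m a 1 (Z.to_nat (k (S r)))).
    { rewrite block_sum_partial_sums.
      pose proof (sum_n_m_nonneg a 1 (Z.to_nat (k r)) a_nonneg); lra. }
    assert (Hinv : 1 / h k r <= (1 + d) / d * (1 / IZR (k (S r)))).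
    (* As a comparison of reciprocals, the claim becomes [d k_{r+1} / (1 + d) <= k_{r+1} - k_r], a
       rearrangement of [(1 + d) k_r <= k_{r+1}]. *)
    { replace ((1 + d) / d * (1 / IZR (k (S r))))
        with (1 / (d * IZR (k (S r)) / (1 + d))) by (field; lra).
      apply Rmult_le_compat_l; [lra |].
      apply Rinv_le_contravar.
      - apply Rdiv_lt_0_compat; [now apply Rmult_lt_0_compat | lra].
      - apply Rle_div_l; [lra |].
        unfold h; rewrite minus_IZR; nra. }
    assert (Hh' : 0 < 1 / h k r) by (apply Rdiv_lt_0_compat; lra).
    split; [nra |].
    unfold u; rewrite INR_to_nat by lia.
    rewrite <- Rmult_assoc.
    apply Rmult_le_compat; lra.
  - apply is_lim_seq_const.
  - replace (Finite 0) with (Rbar_mult ((1 + d) / d) 0)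
      by (simpl; now rewrite Rmult_0_r).
    apply is_lim_seq_scal_l.
    apply (filterlim_comp _ _ _ (fun r => Z.to_nat (k (S r))) u
             eventually eventually); [| exact Hlim].
    apply (filterlim_comp _ _ _ S (fun r => Z.to_nat (k r))
             eventually eventually); [| exact incr_unbounded].
    apply eventually_subseq; intros; lia.
Qed.

(** Climb block by block from [N]: either the block of [t] has been met, or [k (N + j)] is still at
    most [t]. Linear growth rules out the latter for large [j]. *)
Lemma block_containing (N t : nat) : (Z.to_nat (k N) <= t)%nat ->
  exists r, (N <= r)%nat /\ (Z.to_nat (k r) <= t)%nat /\ (t < Z.to_nat (k (S r)))%nat.
Proof.
  intros Ht.
  assert (Hex : forall j, (exists r, (N <= r)%nat /\ (Z.to_nat (k r) <= t)%nat /\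
                             (t < Z.to_nat (k (S r)))%nat) \/
                          (Z.to_nat (k (N + j)) <= t)%nat).
  { induction j as [| j [IH | IH]].
    - right; now rewrite Nat.add_0_r.
    - now left.
    - rewrite Nat.add_succ_r.
      destruct (Nat.le_gt_cases (Z.to_nat (k (S (N + j)))) t) as [Hle | Hgt].
      + now right.
      + left; exists (N + j)%nat; repeat split; auto; lia. }
  destruct (Hex (S t + Z.to_nat (- k 0))%nat) as [H | H]; [exact H |].
  pose proof (incr_ge_linear (N + (S t + Z.to_nat (- k 0)))); lia.
Qed.

Lemma partial_sum_le_of_block_le (e : R) (N r : nat) :
  (forall i, (N <= i)%nat -> block_sum k a i <= e * h k i) -> (N <= r)%nat ->
  sum_n_m a 1 (Z.to_nat (k r)) <=
  sum_n_m a 1 (Z.to_nat (k N)) + e * (IZR (k r) - IZR (k N)).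
Proof.
  intros Hb Hr; induction Hr as [| r Hr IH]; [lra |].
  rewrite block_sum_partial_sums.
  specialize (Hb r Hr); unfold h in Hb; rewrite minus_IZR in Hb; lra.
Qed.

Lemma means_of_block_means :
  Rbar_lt (LimSup_seq (q k)) p_infty ->
  is_lim_seq (fun r => 1 / h k r * block_sum k a r) 0 ->
  is_lim_seq (fun t => 1 / INR t * sum_n_m a 1 t) 0.
Proof.
  intros Hsup Hlim.
  destruct (LimSup_seq_bounded_eventually _ Hsup) as [M0 HM0].
  (* The maximum with 1 makes the bound positive, so that [eps] can be divided by it. *)
  set (M := Rmax M0 1).
  assert (HM : 1 <= M) by apply Rmax_r.
  apply is_lim_seq_spec; intros eps; apply is_lim_seq_spec in Hlim.
  (* Half of [eps] is reserved for the initial sum [A]; the factor [M] is lost when passing from [t]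
     to the end [k_{r+1} <= M t] of its block. *)
  assert (He : 0 < eps / (2 * M))
    by (apply Rdiv_lt_0_compat; [apply cond_pos | lra]).
  destruct (filter_and _ _ (filter_and _ _ HM0 incr_eventually_pos)
              (Hlim (mkposreal _ He))) as [N HN]; simpl in HN.
  set (e := eps / (2 * M)) in *.
  set (A := sum_n_m a 1 (Z.to_nat (k N))).
  assert (HA : 0 <= A) by now apply sum_n_m_nonneg.
  assert (Hb : forall i, (N <= i)%nat -> block_sum k a i <= e * h k i).
  { intros i Hi; destruct (HN i Hi) as [_ Hi'].
    rewrite Rminus_0_r in Hi'.
    apply Rabs_def2 in Hi'; destruct Hi' as [Hi' _].
    pose proof (h_pos i) as Hh.
    replace (block_sum k a i) with (1 / h k i * block_sum k a i * h k i)
      by (field; lra).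
    apply Rmult_le_compat_r; lra. }
  (* With [T] the integer part of [2 A / eps], any [t >= T + 1] gives [A < eps t / 2]. *)
  destruct (nfloor_ex (2 * A / eps)) as [T [_ HT]].
  { apply Rdiv_le_0_compat; [lra | apply cond_pos]. }
  exists (S T + Z.to_nat (k N))%nat; intros t Ht.
  destruct (block_containing N t) as [r [Hr [Hrt Htr]]]; [lia |].
  destruct (HN r Hr) as [[Hq Hk] _].
  assert (Hk' : 0 < IZR (k r)) by now apply (IZR_lt 0).
  assert (HkN : 0 < IZR (k N)) by (apply (IZR_lt 0), (HN N); lia).
  assert (Hkt : IZR (k r) <= INR t)
    by (rewrite <- INR_to_nat by lia; now apply le_INR).
  assert (HkM : IZR (k (S r)) <= M * IZR (k r)).
  { apply Rle_div_l; [lra |].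
    pose proof (Rmax_l M0 1) as HM0M; unfold q in Hq; fold M in HM0M; lra. }
  (* Extend the sum to the end of the block, apply the telescoped bound, and discard [- e k_N],
     which is negative because [k_N > 0]. *)
  assert (HS : sum_n_m a 1 t <= A + e * (M * INR t)).
  { apply Rle_trans with (sum_n_m a 1 (Z.to_nat (k (S r)))).
    - apply sum_from_1_le; [exact a_nonneg | lia].
    - pose proof (partial_sum_le_of_block_le e N (S r) Hb ltac:(lia)) as Hp.
      fold A in Hp.
      apply Rle_trans with (1 := Hp).
      apply Rplus_le_compat_l, Rmult_le_compat_l; nra. }
  assert (Ht0 : INR T + 1 <= INR t) by (rewrite <- S_INR; apply le_INR; lia).
  assert (HAt : 2 * A < INR t * eps).
  { apply Rlt_div_l; [apply cond_pos | lra]. }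
  assert (Htpos : 0 < INR t) by lra.
  assert (HeM : e * (M * INR t) = eps / 2 * INR t) by (unfold e; field; lra).
  pose proof (sum_n_m_nonneg a 1 t a_nonneg) as HS0.
  rewrite Rminus_0_r, Rabs_pos_eq.
  - replace (1 / INR t * sum_n_m a 1 t) with (sum_n_m a 1 t / INR t) by (field; lra).
    apply Rlt_div_l; lra.
  - apply Rmult_le_pos; [| exact HS0].
    apply Rdiv_le_0_compat; lra.
Qed.

End IncreasingIndices.

Theorem corollary2p8 (k : nat -> Z) (hk : lacunary k)
  (hinf : Rbar_lt 1 (LimInf_seq (q k)))
  (hle : Rbar_le (LimInf_seq (q k)) (LimSup_seq (q k)))
  (hsup : Rbar_lt (LimSup_seq (q k)) p_infty) :
  AC_theta k = AC_sigma1.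
Proof.
  destruct hk as [k_incr _].
  apply functional_extensionality; intros x.
  apply propositional_extensionality.
  split; intros [n [Hn Hlim]]; exists n; (split; [exact Hn |]).
  (* [arith_dev x n] is a modulus, which supplies the nonnegativity required in both directions. *)
  - apply (means_of_block_means k); auto; intros; apply Cmod_ge_0.
  - apply block_means_of_means; auto; intros; apply Cmod_ge_0.
Qed.
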